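(* Let $\mathcal{H}$ be a Hilbert space, let $n\ge1$, let $\delta$ be a real number, and suppose $\mathsf{P}_1,\dots,\mathsf{P}_n$ are orthogonal projections with respect to the inner product of $\mathcal{H}$ satisfying $$\left\|\frac1n\sum_{i=1}^n\mathsf{P}_i\right\|_{\mathsf{op}}\le 1-\delta.$$ Let $i_1,i_2,\dots$ be independent, uniformly random indices in $[n]=\{1,\dots,n\}$, and let $L$ denote the first index for which $\{i_1,\dots,i_L\}=[n]$. Then there is an event $\mathcal{E}$ such that: (i) $\Pr(\mathcal{E})=1-o(1)$; (ii) on $\mathcal{E}$, it holds that $L\le 2n\log n$ and $$\|\mathsf{P}_{i_L}\cdots\mathsf{P}_{i_1}\|_{\mathsf{op}}\le 1-\frac{\delta}{32n};$$ (iii) the event $\mathcal{E}$ can be certified to hold in linear time given the indices $i_1,\dots,i_L$ as input.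
   Context: For a bounded linear operator $\mathsf{A}:\mathcal{H}\to\mathcal{H}$, $\|\mathsf{A}\|_{\mathsf{op}}=\sup_{f\in\mathcal{H},\,f\neq0}\|\mathsf{A}f\|/\|f\|$, where $\|\cdot\|$ is the norm induced by the inner product. Here $o(1)$ denotes a function of $n$ alone tending to $0$ as $n\to\infty$. Statement (iii) means that $\mathcal{E}$ is determined by $(i_1,\dots,i_L)$ and that there is an algorithm which, given $(i_1,\dots,i_L)$, decides whether $\mathcal{E}$ holds in time linear in the input length. *)

(* Defs.v *)
From mathcomp Require Export all_boot all_order all_algebra.
From mathcomp Require Export sesquilinear complex.
From mathcomp Require Export all_classical all_reals all_analysis.
Export Order.TTheory GRing.Theory Num.Theory numFieldNormedType.Exports.

Set Implicit Arguments.
Unset Strict Implicit.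
Unset Printing Implicit Defensive.

Local Open Scope classical_set_scope.
Local Open Scope ring_scope.

(* Hilbert spaces are taken over either the reals or the complex numbers. *)
Inductive scalar_kind := RealScalars | ComplexScalars.

Definition scalar (R : realType) (F : scalar_kind) : numFieldType :=
  match F with
  | RealScalars => R
  | ComplexScalars => R[i]
  end.

Definition scalar_conj (R : realType) (F : scalar_kind) : scalar R F -> scalar R F :=
  match F with
  | RealScalars => idfun
  | ComplexScalars => @conjc R
  end.

Definition scalar_re (R : realType) (F : scalar_kind) : scalar R F -> R :=
  match F with
  | RealScalars => idfun
  | ComplexScalars => @complex.Re R
  end.

Section Operators.
Variables (R : realType) (F : scalar_kind).
Variable H : completeNormedModType (scalar R F).

(* The library norm is scalar-valued, whence [scalar_re].  [sup] is 0 on the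
   empty set (the case H = 0) and on unbounded sets, so this is meaningful for
   bounded operators only; orthogonal projections are always bounded. *)
Definition op_norm (A : H -> H) : R :=
  sup [set scalar_re `|A f| / scalar_re `|f| | f in [set f | f != 0]].

Definition orthogonal_projection (ip : {dot H for @scalar_conj R F})
    (P : {linear H -> H}) : Prop :=
  (forall f, P (P f) = P f) /\ (forall f g, ip (P f) g = ip f (P g)).

(* [ordered_product P [:: i_1; ...; i_L]] is P_{i_L} o ... o P_{i_1}. *)
Definition ordered_product n (P : 'I_n -> {linear H -> H}) (s : seq 'I_n)
    (f : H) : H :=
  foldl (fun g i => P i g) f s.

End Operators.

(* [x k] is the index i_{k+1}, and [n] = {1, ..., n} is represented by 'I_n, so
   that [mkseq x l] is the sequence (i_1, ..., i_l). *)
Definition first_cover_time n (x : nat -> 'I_n) (L : nat) : Prop :=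
  (forall i, i \in mkseq x L) /\
  (forall l, (l < L)%N -> ~ (forall i, i \in mkseq x l)).

Definition iid_uniform (R : realType) d (Omega : measurableType d)
    (Pr : probability Omega R) n (X : nat -> Omega -> 'I_n) : Prop :=
  [/\ forall k i, measurable (X k @^-1` [set i]),
      forall k i, Pr (X k @^-1` [set i]) = (n%:R^-1)%:E
    & forall (J : seq nat) (A : nat -> set 'I_n), uniq J ->
        Pr (\bigcap_(k in [set` J]) (X k @^-1` A k)) =
        (\prod_(k <- J) Pr (X k @^-1` A k))%E ].

(* The machine model is the word RAM: unit-cost instructions on words of
   O(log N) bits, N being the number of words of the input.  The operands d, a,
   b of the instructions are register numbers. *)
Inductive instr :=
| IConst of nat & nat            (* r[d] := v *)
| IAdd of nat & nat & nat        (* r[d] := r[a] + r[b] *)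
| ISub of nat & nat & nat        (* r[d] := r[a] - r[b], truncated at 0 *)
| IMul of nat & nat & nat        (* r[d] := r[a] * r[b] *)
| IRead of nat & nat             (* r[d] := mem[r[a]] *)
| IWrite of nat & nat            (* mem[r[a]] := r[b] *)
| IJump of nat                   (* goto t *)
| IJumpLt of nat & nat & nat     (* if r[a] < r[b] then goto t *)
| IHalt of bool.

Record ram_state := RamState {
  pc : nat;
  reg : nat -> nat;
  mem : nat -> nat }.

Definition update (f : nat -> nat) (a v : nat) : nat -> nat :=
  fun b => if b == a then v else f b.

(* Running off the end of the program rejects. *)
Definition ram_instr (p : seq instr) (st : ram_state) : instr :=
  nth (IHalt false) p (pc st).

Definition ram_step (p : seq instr) (st : ram_state) : ram_state :=
  let r := reg st in
  let m := mem st in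
  let next := (pc st).+1 in
  match ram_instr p st with
  | IConst d v => RamState next (update r d v) m
  | IAdd d a b => RamState next (update r d (r a + r b)%N) m
  | ISub d a b => RamState next (update r d (r a - r b)%N) m
  | IMul d a b => RamState next (update r d (r a * r b)%N) m
  | IRead d a => RamState next (update r d (m (r a))) m
  | IWrite a b => RamState next r (update m (r a) (r b))
  | IJump t => RamState t r m
  | IJumpLt a b t => RamState (if (r a < r b)%N then t else next) r m
  | IHalt _ => st
  end.

Definition ram_answer (p : seq instr) (st : ram_state) : option bool :=
  if ram_instr p st is IHalt b then Some b else None.

(* The input is stored in memory, preceded by its length. *)
Definition ram_init (s : seq nat) : ram_state :=
  RamState 0 (fun=> 0%N) (nth 0%N (size s :: s)).

Definition ram_run (p : seq instr) (s : seq nat) (t : nat) : ram_state :=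
  iter t (ram_step p) (ram_init s).

(* The bound on the contents of registers and memory, hence also on the
   addresses used, expresses that words have O(log (size s)) bits. *)
Definition answers_in_linear_time (p : seq instr) (c : nat) (s : seq nat)
    (b : bool) : Prop :=
  exists t, [/\ (t <= c * size s)%N,
    ram_answer p (ram_run p s t) = Some b
  & forall t', (t' <= t)%N -> forall a,
      (reg (ram_run p s t') a <= (size s).+1 ^ c)%N /\
      (mem (ram_run p s t') a <= (size s).+1 ^ c)%N ].

(* The indices are handed to the machine as elements of {1, ..., n}. *)
Definition index_input n (s : seq 'I_n) : seq nat := [seq (val i).+1 | i <- s].

(* Main.v *)
Require Import Defs.
From mathcomp Require Import zify ring lra.

Set Implicit Arguments.
Unset Strict Implicit.
Unset Printing Implicit Defensive.

Local Open Scope classical_set_scope.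
Local Open Scope ring_scope.

(** Write [T_i] for the first time at which the index [i] is drawn.  The idea is
    that the product of the projections loses norm at a rate governed by the sum
    of the [T_i] alone.

    Let [f_0 = f], and let [f_k] be the vector after [k] projections.  By
    Pythagoras each step loses the squared norm [|f_(k-1) - f_k|^2].  As the
    step [T_i] projects to the range of [P_i], the distance [|f - P_i f|] from
    [f] to this range is at most the length of the path [f_0, ..., f_(T_i)], so
    that by Cauchy-Schwarz [|f - P_i f|^2 <= T_i D] where
    [D = |f_0|^2 - |f_L|^2] ([displacement_le_loss]).  The spectral gap says
    that these squares add up to at least [n delta |f|^2]
    ([sum_displacement_ge]).  Therefore, as soon as the [T_i] add up to at most
    [16 n^2], [D >= delta |f|^2 / (16 n)], which is the bound wanted
    ([op_norm_product_le]).

    Each [T_i] has mean [n], so their sum has mean [n^2], and it remains to see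
    that it is unlikely to be 16 times larger.  The sum of the [T_i] is the sum
    over time of the number [U] of indices not yet drawn, and
    [2^U exp (sum of the past values of U / (2 n))] is a supermartingale
    started at [2^n] ([sum_potential_rcons]).  By Markov's inequality the sum
    exceeds [16 n^2] with probability at most [2^n e^(- 8 n)].  That not all
    indices are drawn in [n k] steps, with [k] the binary logarithm of [n]
    rounded down, has probability at most [n e^(- k) <= 2 (2 / e)^k], and
    [n k <= 2 n ln n].

    The event is thus that all indices are drawn in [n k] steps and that the
    [T_i] add up to at most [16 n^2].  It only depends on the first [n k]
    indices, so that its probability is a quotient of cardinals which depends on
    [n] alone ([probability_prefix]); on the other hand it can be read off the
    indices up to the covering time ([good_certified]), by a single scan that
    marks the indices met and adds up the [T_i] ([certifier_linear_time]). *)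

(** The sum of the [T_i], the positions of [index] being counted from 0. *)
Definition total_arrival (T : finType) (s : seq T) : nat :=
  (\sum_i (index i s).+1)%N.

(** * The real inner product of a real or complex Hilbert space *)

Section ScalarRe.
Variables (R : realType) (F : scalar_kind).
Local Notation re := (@scalar_re R F).

Definition scalar_real : R -> scalar R F :=
  match F with
  | RealScalars => idfun
  | ComplexScalars => @real_complex R
  end.

Lemma scalar_re0 : re 0 = 0.
Proof. by case: F. Qed.

Lemma scalar_reD (x y : scalar R F) : re (x + y) = re x + re y.
Proof. by case: F x y => //= -[a b] [c d]. Qed.

Lemma scalar_re_conj (x : scalar R F) : re (scalar_conj x) = re x.
Proof. by case: F x => //= -[a b]. Qed.

Lemma scalar_re_realM (a : R) (x : scalar R F) :
  re (scalar_real a * x) = a * re x.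
Proof. by rewrite /scalar_real; case: F x => //= -[b c] /=; rewrite mul0r subr0. Qed.

Lemma scalar_realV (n : nat) : scalar_real n%:R^-1 = n%:R^-1.
Proof. by rewrite /scalar_real; case: F => //=; rewrite fmorphV rmorph_nat. Qed.

Lemma scalar_re_ge0 (x : scalar R F) : 0 <= x -> 0 <= re x.
Proof. by case: F x => //= -[a b]; rewrite lecE /= => /andP[]. Qed.

Lemma scalar_re_gt0 (x : scalar R F) : 0 < x -> 0 < re x.
Proof. by case: F x => //= -[a b]; rewrite ltcE /= => /andP[]. Qed.

Lemma scalar_re_sqr (x : scalar R F) : 0 <= x -> re (x ^+ 2) = re x ^+ 2.
Proof.
case: F x => //= -[a b]; rewrite lecE /= => /andP[/eqP-> _].
by rewrite /= mul0r subr0.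
Qed.

End ScalarRe.

Section RealInnerProduct.
Variables (R : realType) (F : scalar_kind).
Variable H : completeNormedModType (scalar R F).
Variable ip : {dot H for @scalar_conj R F}.
Implicit Types f g h : H.

(** The real part of the inner product is a real inner product with the same
    norm, so that from here on real and complex scalars are treated alike. *)
Definition rip f g : R := scalar_re (ip f g).
Definition sqnorm f : R := rip f f.

Lemma ripDl f g h : rip (f + g) h = rip f h + rip g h.
Proof. by rewrite /rip linearDl scalar_reD. Qed.

Lemma rip0l g : rip 0 g = 0.
Proof. by rewrite /rip linear0l scalar_re0. Qed.

Lemma ripC f g : rip f g = rip g f.
Proof.
by rewrite /rip hermitian_subproof expr0 mul1r scalar_re_conj.
Qed.

Lemma ripZl (a : R) f g : rip (scalar_real F a *: f) g = a * rip f g.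
Proof. by rewrite /rip linearZl_LR scalar_re_realM. Qed.

Lemma ripDr f g h : rip h (f + g) = rip h f + rip h g.
Proof. by rewrite ripC ripDl !(ripC h). Qed.

Lemma ripNl f g : rip (- f) g = - rip f g.
Proof. by apply/eqP; rewrite -addr_eq0 addrC -ripDl subrr rip0l. Qed.

Lemma ripNr f g : rip g (- f) = - rip g f.
Proof. by rewrite ripC ripNl ripC. Qed.

Lemma ripZr (a : R) f g : rip g (scalar_real F a *: f) = a * rip g f.
Proof. by rewrite ripC ripZl ripC. Qed.

Lemma rip_suml n (u : 'I_n -> H) g :
  rip (\sum_i u i) g = \sum_i rip (u i) g.
Proof.
by elim/big_ind2: _ => [|x1 x2 y1 y2 <- <-|//]; rewrite ?ripDl // rip0l.
Qed.

Hypothesis ip_norm : forall f, `|f| ^+ 2 = ip f f.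

Lemma sqnormE f : sqnorm f = scalar_re `|f| ^+ 2.
Proof. by rewrite /sqnorm /rip -ip_norm scalar_re_sqr // normr_ge0. Qed.

Lemma sqnorm_ge0 f : 0 <= sqnorm f.
Proof. by rewrite sqnormE sqr_ge0. Qed.

Lemma rnorm_gt0 f : f != 0 -> 0 < scalar_re `|f|.
Proof. by rewrite -normr_gt0 => /scalar_re_gt0. Qed.

(** This is Cauchy-Schwarz: expand the square of [a f - g] and divide by
    [2 a]; when [a = 0], [g] vanishes. *)
Lemma rip_le_contraction (a : R) f g :
  0 <= a -> sqnorm g <= a ^+ 2 * sqnorm f -> rip g f <= a * sqnorm f.
Proof.
move=> a_ge0 gf.
have := sqnorm_ge0 (scalar_real F a *: f - g).
rewrite /sqnorm !(ripDl, ripDr, ripNl, ripNr, ripZl, ripZr) (ripC f g) -!/(sqnorm _) => h.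
have [a0|a_gt0] := eqVneq a 0; last first.
  rewrite -(@ler_pM2l _ a) ?lt0r ?a_gt0 //; nra.
have g0 : sqnorm g = 0.
  by apply/eqP; rewrite eq_le sqnorm_ge0 andbT (le_trans gf) // a0 expr0n mul0r.
suff -> : g = 0 by rewrite rip0l mulr_ge0 ?sqnorm_ge0.
apply/eqP; apply: contraTT isT => /rnorm_gt0 ng.
by move: g0; rewrite sqnormE => /eqP; rewrite expf_eq0 /= gt_eqF.
Qed.

Section Projection.
Variable P : {linear H -> H}.
Hypothesis P_proj : orthogonal_projection ip P.

Lemma rip_proj f g : rip (P f) g = rip f (P g).
Proof. by rewrite /rip P_proj.2. Qed.

Lemma rip_proj_sqnorm f : rip (P f) f = sqnorm (P f).
Proof. by rewrite /sqnorm [RHS]rip_proj P_proj.1 rip_proj. Qed.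

Lemma pythagoras f : sqnorm (f - P f) = sqnorm f - sqnorm (P f).
Proof.
rewrite {1}/sqnorm ripDl !ripDr !ripNl !ripNr (ripC f) rip_proj_sqnorm -!/(sqnorm _).
by lra.
Qed.

Lemma sqnorm_proj_le f : sqnorm (P f) <= sqnorm f.
Proof. by rewrite -subr_ge0 -pythagoras sqnorm_ge0. Qed.

Lemma sqnorm_coproj_le f : sqnorm (f - P f) <= sqnorm f.
Proof. by rewrite pythagoras gerBl sqnorm_ge0. Qed.
End Projection.

(** The square of [(k + 1) f - g] is nonnegative. *)
Lemma sqnormD_weighted (k : nat) f g :
  k.+1%:R * sqnorm (f + g) <= k.+1%:R * k.+2%:R * sqnorm f + k.+2%:R * sqnorm g.
Proof.
have := sqnorm_ge0 (scalar_real F k.+1%:R *: f - g).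
rewrite /sqnorm !(ripDl, ripDr, ripNl, ripNr, ripZl, ripZr) (ripC g f) -!/(sqnorm _).
by rewrite -(natr1 k.+1); lra.
Qed.

Section Product.
Variables (n : nat) (P : 'I_n -> {linear H -> H}).
Hypothesis P_proj : forall i, orthogonal_projection ip (P i).

Lemma sqnorm_product_le s f : sqnorm (ordered_product P s f) <= sqnorm f.
Proof.
elim: s f => [|i s IH] f //=.
exact: le_trans (IH _) (sqnorm_proj_le (P_proj i) f).
Qed.

(** When [P i] is first applied, at time [t], the vector enters the range of
    [P i]; it has moved from [f] at least by the distance [|f - P i f|] to this
    range, and every movement is paid for by a loss of norm.  By induction: with
    [f' = P j f] for the first projection [P j],
    [(I - P i) f = (I - P i) (f - f') + (I - P i) f'], where the first summand
    is at most [f - f'] in norm, whose square is exactly the loss of the first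
    step, and the second one is controlled by the losses of the later steps.
    The weights of [sqnormD_weighted] make the constant grow by one at each
    step, which amounts to Cauchy-Schwarz over the [t] steps. *)
Lemma displacement_le_loss (s : seq 'I_n) (i : 'I_n) f : i \in s ->
  sqnorm (f - P i f) <=
  (index i s).+1%:R * (sqnorm f - sqnorm (ordered_product P s f)).
Proof.
elim: s f => [//|j s IH] f; rewrite inE /= [j == i]eq_sym.
have [-> _|ij /= /(IH (P j f)) {}IH] := eqVneq i j.
  by rewrite mul1r (pythagoras (P_proj j)) lerB // sqnorm_product_le.
set k := index i s in IH *.
set f' := P j f in IH *.
set q := sqnorm (ordered_product P s f') in IH *.
have -> : f - P i f = (f - f' - P i (f - f')) + (f' - P i f').
  by rewrite linearB /= opprB addrACA subrK; congr (_ + _); rewrite addrAC subrr add0r.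
have h1 := sqnorm_coproj_le (P_proj i) (f - f').
have h2 := pythagoras (P_proj j) f.
have h3 := sqnormD_weighted k (f - f' - P i (f - f')) (f' - P i f').
have k_gt0 : 0 < k.+1%:R :> R by rewrite ltr0n.
rewrite -(@ler_pM2l _ k.+1%:R) // (le_trans h3) //.
rewrite -/f' in h2.
have -> : k.+1%:R * (k.+2%:R * (sqnorm f - q)) = k.+1%:R * k.+2%:R * sqnorm (f - f') +
   k.+2%:R * (k.+1%:R * (sqnorm f' - q)) by rewrite h2; ring.
by apply: lerD; rewrite ler_wpM2l // mulr_ge0.
Qed.

Lemma op_norm_ge0 (A : H -> H) : 0 <= op_norm A.
Proof.
rewrite /op_norm; set S := (X in sup X).
case: (pselect (has_sup S)) => [[[x Sx] S_ub]|/sup_out -> //].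
apply: le_trans (ub_le_sup S_ub Sx); case: Sx => f _ <-.
by rewrite divr_ge0 // scalar_re_ge0 // normr_ge0.
Qed.

(** The hypothesis [0 <= c] is for the zero space, whose operators have
    norm [sup set0 = 0]. *)
Lemma op_norm_le (A : H -> H) (c : R) : 0 <= c ->
  (forall f, sqnorm (A f) <= c ^+ 2 * sqnorm f) -> op_norm A <= c.
Proof.
move=> c_ge0 Ac.
rewrite /op_norm; set S := (X in sup X).
have [S0|/set0P S_neq0] := eqVneq S set0; first by rewrite S0 sup0.
apply: ge_sup => // _ [f /= f_neq0 <-].
have f_gt0 := rnorm_gt0 f_neq0.
rewrite ler_pdivrMr // -ler_sqr ?nnegrE ?mulr_ge0 ?scalar_re_ge0 //.
by rewrite exprMn -!sqnormE.
Qed.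

(** Since the supremum of an unbounded set is [0], [op_norm A] is a bound only
    for a bounded operator; the hypothesis on [A] ensures this. *)
Lemma sqnorm_le_op_norm (A : H -> H) f :
  (forall g, sqnorm (A g) <= sqnorm g) ->
  sqnorm (A f) <= op_norm A ^+ 2 * sqnorm f.
Proof.
move=> A1.
have [->|f_neq0] := eqVneq f 0.
  have := A1 0; rewrite {2 4}/sqnorm rip0l mulr0; exact.
have f_gt0 := rnorm_gt0 f_neq0.
rewrite !sqnormE -exprMn ler_sqr ?nnegrE ?mulr_ge0 ?scalar_re_ge0 ?op_norm_ge0 //.
rewrite -ler_pdivrMr //; apply: ub_le_sup; last by exists f.
exists 1 => _ [g /= g_neq0 <-].
rewrite ler_pdivrMr ?rnorm_gt0 // mul1r -ler_sqr ?nnegrE ?scalar_re_ge0 //.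
by rewrite -!sqnormE.
Qed.

Lemma rip_average f g : (1 <= n)%N ->
  n%:R * rip (n%:R^-1 *: \sum_(i < n) P i f) g = \sum_(i < n) rip (P i f) g.
Proof.
move=> n_ge1; rewrite -scalar_realV ripZl mulrA divff ?pnatr_eq0 -?lt0n // mul1r.
exact: rip_suml.
Qed.

Lemma sqnorm_average_le f : (1 <= n)%N ->
  sqnorm (n%:R^-1 *: \sum_(i < n) P i f) <= sqnorm f.
Proof.
move=> n_ge1; set A := _ *: _.
have n_gt0 : 0 < n%:R :> R by rewrite ltr0n.
have : n%:R * rip A A <= \sum_(i < n) ((sqnorm f + sqnorm A) / 2).
  rewrite rip_average //; apply: ler_sum => i _.
  have := sqnorm_ge0 (P i f - A); have := sqnorm_proj_le (P_proj i) f.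
  rewrite /sqnorm !(ripDl, ripDr, ripNl, ripNr) (ripC A) -!/(sqnorm _); lra.
rewrite sumr_const card_ord -[X in _ <= X]mulr_natl ler_pM2l // -/(sqnorm A); lra.
Qed.

(** The gap bounds [rip (A f) f] for the average [A], and by Pythagoras the sum
    on the right is [n] times [sqnorm f - rip (A f) f]. *)
Lemma sum_displacement_ge (delta : R) f : (1 <= n)%N ->
  op_norm (fun f : H => n%:R^-1 *: \sum_(i < n) P i f) <= 1 - delta ->
  n%:R * (delta * sqnorm f) <= \sum_(i < n) sqnorm (f - P i f).
Proof.
move=> n_ge1 gap; set A := (fun f : H => _) in gap.
have a_ge0 := le_trans (op_norm_ge0 A) gap.
have Af : rip (A f) f <= (1 - delta) * sqnorm f.
  apply: rip_le_contraction => //.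
  apply: le_trans (sqnorm_le_op_norm _ _) _; first by move=> g; exact: sqnorm_average_le.
  by rewrite ler_wpM2r ?sqnorm_ge0 // ler_sqr // nnegrE op_norm_ge0.
under eq_bigr do rewrite (pythagoras (P_proj _)) -(rip_proj_sqnorm (P_proj _)).
rewrite sumrB -rip_average // sumr_const card_ord -[X in X - _]mulr_natl -mulrBr.
rewrite ler_wpM2l // -/(A f); lra.
Qed.

(** By [displacement_le_loss], the squared displacements add up to at most
    [total_arrival s <= 16 n^2] times the loss of squared norm, and by
    [sum_displacement_ge] to at least [n delta sqnorm f].  Hence that loss is at least
    [delta / (16 n) * sqnorm f], and a square root halves the rate. *)
Lemma op_norm_product_le (delta : R) (s : seq 'I_n) : (1 <= n)%N ->
  op_norm (fun f : H => n%:R^-1 *: \sum_(i < n) P i f) <= 1 - delta ->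
  (forall i, i \in s) ->
  (total_arrival s <= 16 * n ^ 2)%N ->
  op_norm (ordered_product P s) <= 1 - delta / (32 * n%:R).
Proof.
move=> n_ge1 gap s_covers s_early.
have delta_le1 : delta <= 1 by rewrite -subr_ge0 (le_trans (op_norm_ge0 _) gap).
have n_gt0 : 1 <= n%:R :> R by rewrite ler1n.
set e := delta / (32 * n%:R).
have e_delta : e * (32 * n%:R) = delta.
  by rewrite /e divfK // mulf_neq0 // gt_eqF // (lt_le_trans _ n_gt0).
have e_le1 : e <= 1 by nra.
apply: op_norm_le => [|f]; first by lra.
have q_ge0 := sqnorm_ge0 f.
set q' := sqnorm (ordered_product P s f).
have q'_le : q' <= sqnorm f by exact: sqnorm_product_le.
(* For delta <= 0 the product only has to be a contraction. *)
have [delta_le0|delta_gt0] := lerP delta 0.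
  have e_le0 : e <= 0 by nra.
  by nra.
have e_gt0 : 0 < e by nra.
suff h : 2 * e * sqnorm f <= sqnorm f - q' by nra.
have h1 : n%:R * (delta * sqnorm f) <= (16 * n%:R ^+ 2) * (sqnorm f - q').
  apply: le_trans (sum_displacement_ge f n_ge1 gap) _.
  apply: (@le_trans _ _ (\sum_(i < n) ((index i s).+1%:R * (sqnorm f - q')))).
    by apply: ler_sum => i _; exact: displacement_le_loss.
  rewrite -mulr_suml -natr_sum ler_wpM2r ?subr_ge0 //.
  by rewrite -natrX -natrM ler_nat.
have nn : 0 < 16 * n%:R ^+ 2 :> R by rewrite mulr_gt0 // exprn_gt0 // (lt_le_trans _ n_gt0).
rewrite -(ler_pM2l nn); apply: le_trans h1; rewrite -e_delta.
by rewrite [leLHS](_ : _ = n%:R * (e * (32 * n%:R) * sqnorm f)) //; ring.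
Qed.
End Product.

End RealInnerProduct.

(** * Counting the sequences that collect the coupons slowly *)

Lemma trunc_log2_le m : (trunc_log 2 m <= m)%N.
Proof.
case: m => // m; apply: ltnW.
exact: leq_trans (ltn_expl _ _) (trunc_logP _ _).
Qed.

Lemma expR1_gt2 (R : realType) : 2 < expR 1 :> R.
Proof. by rewrite (le_lt_trans _ (expR_gt1Dx _)) // oner_neq0. Qed.

Lemma big_tuple_rcons (V : nmodType) (T : finType) m (f : seq T -> V) :
  \sum_(t : m.+1.-tuple T) f t = \sum_(t : m.-tuple T) \sum_(x : T) f (rcons t x).
Proof.
rewrite pair_big /=.
pose h (p : m.-tuple T * T) : m.+1.-tuple T := [tuple of rcons p.1 p.2].
have h_inj : injective h.
  move=> [t x] [t' x'] /(congr1 val) /= /rcons_inj [tt' ->].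
  by congr pair; exact: val_inj.
rewrite (reindex h) //; apply/onW_bij/(inj_card_bij h_inj).
by rewrite card_prod !card_tuple expnSr.
Qed.

Section Coupons.
Variable n : nat.
Implicit Types s : seq 'I_n.

Definition unseen s : nat := #|[pred i : 'I_n | i \notin s]|.

(** On a covering sequence this is [total_arrival]; capping the arrival time
    of an index not yet seen at the current time makes the increment at each
    step equal to [unseen s], whatever the new index is. *)
Definition capped_arrival s : nat := (\sum_(i < n) minn (index i s).+1 (size s))%N.

Lemma unseen_rcons s a : (unseen (rcons s a) + (a \notin s) = unseen s)%N.
Proof.
rewrite /unseen [in RHS](cardD1 a) addnC inE; congr (_ + _)%N; apply: eq_card => i.
by rewrite !inE mem_rcons inE negb_or.
Qed.

Lemma capped_arrival_rcons s a :
  capped_arrival (rcons s a) = (capped_arrival s + unseen s)%N.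
Proof.
rewrite /capped_arrival /unseen -sum1_card [X in (_ + X)%N]big_mkcond -big_split /=.
apply: eq_bigr => i _; rewrite size_rcons -cats1 index_cat inE.
have [i_s|i_s] := boolP (i \in s); last first.
  by rewrite (memNindex i_s) /=; case: eqP => _; lia.
have h : (index i s < size s)%N by rewrite index_mem.
by rewrite addn0 !(minn_idPl _) ?(leq_trans h).
Qed.

Lemma unseen_eq0 s : reflect (forall i, i \in s) (unseen s == 0%N).
Proof.
apply: (iffP eqP) => [/card0_eq s_all i|s_all]; last by apply: eq_card0 => i; rewrite inE s_all.
by have := s_all i; rewrite !inE => /negbFE.
Qed.

Lemma unseen_nil : unseen [::] = n.
Proof. by rewrite /unseen -[RHS]card_ord; apply: eq_card => i; rewrite !inE. Qed.

Lemma sum_unseen_rcons s :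
  (\sum_(a < n) unseen (rcons s a) + unseen s = n * unseen s)%N.
Proof.
rewrite {2}/unseen -sum1_card [X in (_ + X)%N]big_mkcond -big_split /=.
transitivity (\sum_(a < n) unseen s)%N; last by rewrite sum_nat_const card_ord.
by apply: eq_bigr => a _; rewrite -(unseen_rcons s a) inE; case: (a \notin s).
Qed.

Lemma capped_arrival_cover s : (forall i, i \in s) -> capped_arrival s = total_arrival s.
Proof.
move=> s_all; apply: eq_bigr => i _; apply/minn_idPl.
by rewrite index_mem.
Qed.

Variable R : realType.
Hypothesis n_gt0 : (0 < n)%N.

(** An exponential moment of the arrival times, corrected by a power of two
    that makes it a supermartingale for uniform indices. *)
Definition potential s : R :=
  2 ^+ unseen s * expR ((capped_arrival s)%:R / (2 * n%:R)).

Let nR_gt0 : 0 < n%:R :> R. Proof. by rewrite ltr0n. Qed.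

(** With [u] indices unseen, a uniform index divides the power of two by [2]
    with probability [u / n], hence multiplies it on average by
    [1 - u / (2 n) <= expR (- u / (2 n))]; the other factor of the potential
    grows by exactly [expR (u / (2 n))]. *)
Lemma sum_potential_rcons s :
  \sum_(a < n) potential (rcons s a) <= n%:R * potential s.
Proof.
set u := unseen s.
have -> : \sum_(a < n) potential (rcons s a) =
    (\sum_(a < n) 2 ^+ unseen (rcons s a)) *
    expR ((capped_arrival s + u)%:R / (2 * n%:R)).
  by rewrite mulr_suml; apply: eq_bigr => a _; rewrite /potential capped_arrival_rcons.
have -> : \sum_(a < n) 2 ^+ unseen (rcons s a) = 2 ^+ u * (n%:R - u%:R / 2) :> R.
  transitivity (\sum_(a < n) 2 ^+ u * (1 - (a \notin s)%:R / 2) : R).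
    apply: eq_bigr => a _; rewrite /u -(unseen_rcons s a).
    by case: (a \notin s); rewrite /= ?addn1 ?addn0 ?exprS; lra.
  rewrite -mulr_sumr sumrB sumr_const card_ord -mulr_suml -natr_sum.
  congr (_ * (_ - _%:R / _)); rewrite /u /unseen -sum1_card [RHS]big_mkcond /=.
  by apply: eq_bigr => a _; rewrite inE; case: (a \notin s).
rewrite natrD mulrDl expRD /potential -/u.
set e := expR ((capped_arrival s)%:R / _).
have e_gt0 : 0 < e by exact: expR_gt0.
set x := u%:R / (2 * n%:R).
have -> : n%:R - u%:R / 2 = n%:R * (1 - x) by rewrite /x; field; rewrite gt_eqF.
have h : (1 - x) * expR x <= 1.
  rewrite -ler_pdivlMr ?expR_gt0 // mul1r -expRN; exact: expR_ge1Dx.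
rewrite [leLHS](_ : _ = n%:R * (2 ^+ u * e) * ((1 - x) * expR x)); last by ring.
by rewrite ler_piMr // mulr_ge0 ?ler0n // mulr_ge0 ?exprn_ge0 // ltW.
Qed.

Lemma sum_tuple0 (f : seq 'I_n -> R) : \sum_(t : 0.-tuple 'I_n) f t = f [::].
Proof.
rewrite (eq_bigr (fun=> f [::])) => [|t _]; last by rewrite tuple0.
by rewrite sumr_const card_tuple expn0.
Qed.

Lemma sum_potential m : \sum_(t : m.-tuple 'I_n) potential t <= n%:R ^+ m * 2 ^+ n.
Proof.
elim: m => [|m IH].
  rewrite sum_tuple0 /potential unseen_nil /capped_arrival big1 => [|i _].
    by rewrite mul0r expR0 mulr1 mul1r.
  by rewrite /= minn0.
rewrite big_tuple_rcons exprS -mulrA.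
apply: (@le_trans _ _ (\sum_(t : m.-tuple 'I_n) n%:R * potential t)).
  by apply: ler_sum => t _; exact: sum_potential_rcons.
by rewrite -mulr_sumr ler_pM2l.
Qed.

Lemma sum_unseen m :
  \sum_(t : m.-tuple 'I_n) (unseen t)%:R = n%:R * (n%:R - 1) ^+ m :> R.
Proof.
elim: m => [|m IH]; first by rewrite (sum_tuple0 (fun s => (unseen s)%:R)) unseen_nil mulr1.
rewrite (big_tuple_rcons _ (fun s => (unseen s)%:R)) exprSr mulrA -IH mulr_suml.
apply: eq_bigr => t _; have := congr1 (fun k => k%:R : R) (sum_unseen_rcons t).
rewrite natrD natr_sum natrM => h.
by rewrite mulrBr mulr1 [_ * n%:R]mulrC -h addrK.
Qed.

Definition good s : bool := (unseen s == 0%N) && (total_arrival s <= 16 * n ^ 2)%N.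

(** Markov's inequality, pointwise: either some index is unseen, or the
    potential is at least [expR (16 n^2 / (2 n)) = expR (8 n)]. *)
Lemma bad_le s : (~~ good s)%:R <= (unseen s)%:R + potential s * expR (- 8 * n%:R) :> R.
Proof.
have pot_ge0 : 0 <= potential s by rewrite mulr_ge0 ?expR_ge0 ?exprn_ge0.
have [/unseen_eq0 s_all|] := boolP (unseen s == 0%N); last first.
  rewrite -lt0n /good => u_gt0; rewrite gtn_eqF //= (le_trans (_ : _ <= (unseen s)%:R)) ?ler1n //.
  by rewrite lerDl mulr_ge0 ?expR_ge0.
rewrite /good; have /unseen_eq0 /eqP u0 := s_all; rewrite u0 eqxx add0r /=.
case: leqP => /= late; first by rewrite mulr_ge0 ?expR_ge0.
rewrite /potential u0 expr0 mul1r -expRD -[leLHS]expR0 ler_expR capped_arrival_cover //.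
have : (16 * n ^ 2)%:R <= (total_arrival s)%:R :> R by rewrite ler_nat ltnW.
rewrite natrM natrX => h.
have -> : - 8 * n%:R = - ((16%:R * n%:R ^+ 2) / (2 * n%:R)) :> R.
  by field; rewrite gt_eqF.
by rewrite -mulrBl divr_ge0 ?subr_ge0 // mulr_ge0 // ltW.
Qed.

Definition bad_fraction m : R :=
  (#|[pred t : m.-tuple 'I_n | ~~ good t]|)%:R / n%:R ^+ m.

Lemma good_fraction m :
  #|[pred t : m.-tuple 'I_n | good t]|%:R / n%:R ^+ m = 1 - bad_fraction m.
Proof.
apply/eqP; rewrite eq_sym subr_eq -mulrDl -natrD.
have -> : (#|[pred t : m.-tuple 'I_n | good t]| +
           #|[pred t : m.-tuple 'I_n | ~~ good t]| = n ^ m)%N.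
  by rewrite -[in RHS](card_ord n) -card_tuple -(cardC [pred t : m.-tuple 'I_n | good t]).
by rewrite natrX divff // expf_neq0 // gt_eqF.
Qed.

Lemma bad_fraction_le m : bad_fraction m <=
  n%:R * (1 - n%:R^-1) ^+ m + 2 ^+ n * expR (- 8 * n%:R).
Proof.
have nm_gt0 : 0 < n%:R ^+ m :> R by exact: exprn_gt0.
rewrite ler_pdivrMr // mulrDl -mulrA -exprMn mulrBl mul1r mulVf ?gt_eqF //.
rewrite -sum_unseen mulrAC -sum1_card big_mkcond natr_sum /=.
apply: le_trans (_ : \sum_(t : m.-tuple 'I_n)
   ((unseen t)%:R + potential t * expR (- 8 * n%:R)) <= _).
  by apply: ler_sum => t _; have := bad_le t; rewrite inE; case: (good t).
rewrite big_split lerD2l /= -mulr_suml ler_wpM2r ?expR_ge0 // mulrC.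
exact: sum_potential.
Qed.

(** With [k = trunc_log 2 n], [n (1 - 1 / n)^(n k) <= 2^(k + 1) e^(- k)], and
    [2^n e^(- 8 n) <= (2 / e)^n <= (2 / e)^k]. *)
Lemma bad_fraction_log :
  bad_fraction (n * trunc_log 2 n) <= 3 * (2 / expR 1) ^+ trunc_log 2 n.
Proof.
set k := trunc_log 2 n.
apply: le_trans (bad_fraction_le _) _.
have e_gt2 := expR1_gt2 R.
have e_gt0 : 0 < expR 1 :> R by exact: expR_gt0.
have q_ge0 : 0 <= 2 / expR 1 :> R by rewrite divr_ge0 // ltW.
have q_le1 : 2 / expR 1 <= 1 :> R by rewrite ler_pdivrMr // mul1r ltW.
have -> : 3 = 2 + 1 :> R by ring.
rewrite mulrDl mul1r lerD //.
  have h : (1 - n%:R^-1) ^+ (n * k) <= (expR 1)^-1 ^+ k :> R.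
    rewrite exprM -expRN lerXn2r ?nnegrE ?expR_ge0 //.
      by rewrite exprn_ge0 // subr_ge0 invf_le1 // ler1n.
    have -> : -1 = n%:R * - n%:R^-1 :> R by rewrite mulrN divff // gt_eqF.
    rewrite expRM_natl lerXn2r ?nnegrE ?expR_ge0 //; last exact: expR_ge1Dx.
    by rewrite subr_ge0 invf_le1 // ler1n.
  rewrite exprMn mulrA; apply: ler_pM => //.
    by rewrite exprn_ge0 // subr_ge0 invf_le1 // ler1n.
  by rewrite -exprS -natrX ler_nat ltnW // trunc_log_ltn.
rewrite mulrC expRM_natr -exprMn.
apply: le_trans (_ : (2 / expR 1) ^+ n <= _).
  rewrite lerXn2r ?nnegrE ?mulr_ge0 ?expR_ge0 // mulrC ler_pM2l // -expRN ler_expR.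
  lra.
by rewrite ler_wiXn2l // trunc_log2_le.
Qed.

End Coupons.

Lemma bad_fraction_cvg (R : realType) :
  (@bad_fraction n R (n * trunc_log 2 n)) @[n --> \oo] --> (0 : R).
Proof.
have e_gt2 := expR1_gt2 R.
have e_gt0 : 0 < expR 1 :> R by exact: expR_gt0.
have log_oo : trunc_log 2 n @[n --> \oo] --> \oo.
  apply/cvgnyPge => A; exists (2 ^ A)%N => // n /= An.
  exact: trunc_log_max.
have geo : 3 * (2 / expR 1) ^+ trunc_log 2 n @[n --> \oo] --> (0 : R).
  apply: (cvg_comp (trunc_log 2) (geometric 3 (2 / expR 1)) log_oo).
  apply: cvg_geometric.
  by rewrite ger0_norm ?divr_ge0 ?ltW // ltr_pdivrMr // mul1r.
apply: squeeze_cvgr (cvg_cst 0) geo; exists 1%N => // n /= n_gt0.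
by rewrite bad_fraction_log // andbT divr_ge0.
Qed.

(** * Probability of an event determined by finitely many indices *)

Section Cylinders.
Variables (R : realType) (d : measure_display) (Omega : measurableType d).
Variables (Pr : probability Omega R) (n : nat) (X : nat -> Omega -> 'I_n).
Hypotheses (n_gt0 : (0 < n)%N) (X_iid : iid_uniform Pr X).

Definition prefix_event m (s : seq 'I_n) : set Omega := [set w | mkseq (X ^~ w) m = s].

Lemma prefix_eventE m (t : m.-tuple 'I_n) :
  prefix_event m t =
  \bigcap_(k in [set` iota 0 m]) (X k @^-1` [set nth (Ordinal n_gt0) t k]).
Proof.
apply/seteqP; split=> w /=.
  move=> wt k /=; rewrite mem_iota add0n => /andP[_ k_lt] /=.
  by rewrite -wt nth_mkseq.
move=> wt; apply: (@eq_from_nth _ (Ordinal n_gt0)); rewrite size_mkseq ?size_tuple // => k k_lt.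
by rewrite nth_mkseq //; apply: wt; rewrite /= mem_iota.
Qed.

Lemma measurable_prefix_event m (t : m.-tuple 'I_n) : measurable (prefix_event m t).
Proof.
rewrite prefix_eventE; case: X_iid => X_meas _ _.
by apply: fin_bigcap_measurable => // k _.
Qed.

Lemma probability_prefix_event m (t : m.-tuple 'I_n) :
  Pr (prefix_event m t) = (n%:R ^- m)%:E.
Proof.
rewrite prefix_eventE; case: X_iid => _ X_unif X_indep.
rewrite (X_indep _ (fun k => [set nth (Ordinal n_gt0) t k])) ?iota_uniq //.
under eq_bigr do rewrite X_unif.
have -> : iota 0 m = index_iota 0 m by rewrite /index_iota subn0.
by rewrite prodEFin prodr_const_nat subn0 exprVn.
Qed.

Lemma probability_prefix m (C : pred (seq 'I_n)) :
  measurable [set w | C (mkseq (X ^~ w) m)] /\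
  Pr [set w | C (mkseq (X ^~ w) m)] =
    (#|[pred t : m.-tuple 'I_n | C t]|%:R / n%:R ^+ m)%:E.
Proof.
set r := enum [pred t : m.-tuple 'I_n | C t].
have -> : [set w | C (mkseq (X ^~ w) m)] = \bigcup_(t in [set` r]) prefix_event m t.
  apply/seteqP; split=> w /=.
    have sz : size (mkseq (X ^~ w) m) == m by rewrite size_mkseq.
    by move=> Cw; exists (Tuple sz) => //; rewrite /= mem_enum.
  by case=> t /=; rewrite mem_enum inE /prefix_event /= => Ct ->.
split; first by apply: fin_bigcup_measurable => // t _; exact: measurable_prefix_event.
rewrite measure_fin_bigcup //; last 2 first.
  move=> t t' _ _ [w []] /= tw t'w; apply/val_inj; rewrite /= -tw; exact t'w.
  by move=> t _; exact: measurable_prefix_event.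
rewrite -fsbig_seq ?enum_uniq // /r big_enum /=.
rewrite (eq_bigr (fun=> (n%:R ^- m)%:E)) => [|t _]; last exact: probability_prefix_event.
by rewrite sumEFin sumr_const -[X in X%:E = _]mulr_natl.
Qed.
End Cylinders.

(** * A linear-time certifier *)

Section LinearTime.
Local Open Scope nat_scope.

Definition word_bounded (B : nat) (st : ram_state) : Prop :=
  forall a, reg st a <= B /\ mem st a <= B.

(** Carrying the word bound along the run lets it be checked one written value
    at a time. *)
Inductive exec (p : seq instr) (B : nat) : nat -> ram_state -> ram_state -> Prop :=
| exec_refl st : word_bounded B st -> exec p B 0 st st
| exec_step t st st' : word_bounded B st -> exec p B t (ram_step p st) st' ->
    exec p B t.+1 st st'.

Section Exec.
Variables (p : seq instr) (B : nat).

Lemma exec_trans t1 t2 st1 st2 st3 :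
  exec p B t1 st1 st2 -> exec p B t2 st2 st3 -> exec p B (t1 + t2) st1 st3.
Proof.
by elim=> // t st st' bst _ IH /IH; rewrite addSn; exact: exec_step.
Qed.

Lemma exec_iter t st st' : exec p B t st st' ->
  iter t (ram_step p) st = st' /\
  forall t', t' <= t -> word_bounded B (iter t' (ram_step p) st).
Proof.
elim=> [{}st bst|{}t {}st {}st' bst _ [run_st IH]].
  by split=> // t'; rewrite leqn0 => /eqP ->.
split=> [|[//|t'] t'_le]; first by rewrite iterSr.
by rewrite iterSr; exact: IH.
Qed.

Lemma exec_jump t c r m c' st' :
  ram_step p (RamState c r m) = RamState c' r m ->
  word_bounded B (RamState c r m) ->
  exec p B t (RamState c' r m) st' ->
  exec p B t.+1 (RamState c r m) st'.
Proof. by move=> step_eq bst ex; apply: exec_step; rewrite ?step_eq. Qed.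

Lemma exec_reg d v t c r m c' st' :
  ram_step p (RamState c r m) = RamState c' (update r d v) m ->
  word_bounded B (RamState c r m) -> v <= B ->
  (word_bounded B (RamState c' (update r d v) m) ->
   exec p B t (RamState c' (update r d v) m) st') ->
  exec p B t.+1 (RamState c r m) st'.
Proof.
move=> step_eq bst v_le ex; apply: exec_step; rewrite ?step_eq //.
by apply: ex => a; case: (bst a) => /= ra ma; rewrite /update; case: ifP.
Qed.

Lemma exec_mem d v t c r m c' st' :
  ram_step p (RamState c r m) = RamState c' r (update m d v) ->
  word_bounded B (RamState c r m) -> v <= B ->
  (word_bounded B (RamState c' r (update m d v)) ->
   exec p B t (RamState c' r (update m d v)) st') ->
  exec p B t.+1 (RamState c r m) st'.
Proof.
move=> step_eq bst v_le ex; apply: exec_step; rewrite ?step_eq //.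
by apply: ex => a; case: (bst a) => /= ra ma; rewrite /update; case: ifP.
Qed.

End Exec.

(** Register 1 holds the constant 1, register 2 the length [L] of the input and
    register 3 the position [j] of the scan; 4 and 5 are scratch.  The cell at
    address [L + a] is set to 1 once the index [a] has been read.  Register 6
    counts the distinct indices, register 7 sums their arrival times, and
    register 9 holds the binary logarithm of register 6, kept up to date by
    comparing with its next power of two in register 8.  The instructions 3 to
    16 are the loop; those from 17 on decide whether [L <= n * trunc_log 2 n]
    and [total_arrival <= 16 n^2]. *)
Definition certifier : seq instr :=
  [:: IConst 1 1;        (* 0 *)
      IRead 2 0;
      IConst 8 2;
      IJumpLt 3 2 5;     (* 3 *)
      IJump 17;
      IAdd 3 3 1;        (* 5 *)
      IRead 4 3;
      IAdd 4 4 2;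
      IRead 5 4;
      IJumpLt 0 5 3;
      IWrite 4 1;        (* 10 *)
      IAdd 6 6 1;
      IAdd 7 7 3;
      IJumpLt 6 8 3;
      IAdd 9 9 1;
      IAdd 8 8 8;        (* 15 *)
      IJump 3;
      IMul 5 6 9;        (* 17 *)
      IJumpLt 5 2 24;
      IMul 5 6 6;
      IConst 4 16;       (* 20 *)
      IMul 5 5 4;
      IJumpLt 5 7 24;
      IHalt true;
      IHalt false].

(** The time bound is [n * trunc_log 2 n] and not [2 n ln n], which the machine
    could not compare with exactly; since [1 / 2 <= ln 2] it is the smaller of
    the two, and it still exceeds the typical covering time [n ln n]. *)
Definition certified (n : nat) (s : seq 'I_n) : bool :=
  (size s <= n * trunc_log 2 n) && (total_arrival s <= 16 * n ^ 2).

Section Certifier.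
Variables (n : nat) (s : seq 'I_n) (B : nat).
Hypothesis n_gt0 : 0 < n.
Hypothesis s_covers : forall i, i \in s.
Hypothesis B_large : 16 * (size s * size s) <= B.
Local Notation L := (size s).

Lemma cover_size : n <= L.
Proof.
by have := card_size s; rewrite (@eq_card _ _ [in 'I_n]) ?card_ord.
Qed.

Lemma cover_size_gt0 : 0 < L. Proof. exact: leq_trans cover_size. Qed.
Lemma cover_size_le : 16 * L <= B.
Proof. by apply: leq_trans B_large; rewrite leq_mul2l leq_pmulr ?cover_size_gt0. Qed.

Definition seen j : nat := #|[pred i in take j s]|.
Definition partial_arrival j : nat := \sum_(i in take j s) (index i s).+1.

Lemma seen_le j : seen j <= n.
Proof. by rewrite -[X in _ <= X]card_ord max_card. Qed.

Lemma partial_arrival_le j : partial_arrival j <= n * L.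
Proof.
apply: leq_trans (_ : \sum_(i in 'I_n) L <= _); last by rewrite sum_nat_const card_ord.
rewrite /partial_arrival [leqLHS]big_mkcond /=; apply: leq_sum => i _.
by case: ifP => // _; rewrite index_mem s_covers.
Qed.

Lemma seenS j (x : 'I_n) : j < L -> x = nth x s j ->
  seen j.+1 = (x \notin take j s) + seen j.
Proof.
move=> j_lt xE; rewrite /seen (take_nth x) // -xE.
rewrite -(cardU1 x [in take j s]); apply: eq_card => i.
by rewrite !inE mem_rcons inE.
Qed.

Lemma partial_arrivalS j (x : 'I_n) : j < L -> x = nth x s j ->
  partial_arrival j.+1 =
  (if x \in take j s then 0 else j.+1) + partial_arrival j.
Proof.
move=> j_lt xE; rewrite /partial_arrival (take_nth x) // -xE.
case: ifPn => x_seen.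
  apply: eq_bigl => i; rewrite mem_rcons inE.
  by case: eqP => // ->.
rewrite (bigD1 x) ?mem_rcons ?mem_head //=; congr (_ + _).
  rewrite -[s in index _ s](cat_take_drop j s) index_cat (negbTE x_seen).
  rewrite (drop_nth x) // -xE /= eqxx addn0 size_takel // ltnW //.
apply: eq_bigl => i; rewrite mem_rcons inE.
case: eqP => [->|_]; by rewrite ?andbF ?andbT ?(negbTE x_seen).
Qed.

(** The state before position [j] (counted from 0) is scanned. *)
Definition loop_inv (j : nat) (st : ram_state) : Prop :=
  exists r m, [/\ st = RamState 3 r m,
    [/\ r 0 = 0, r 1 = 1, r 2 = L & r 3 = j],
    [/\ r 6 = seen j, r 7 = partial_arrival j,
        r 8 = 2 ^ (trunc_log 2 (seen j)).+1 & r 9 = trunc_log 2 (seen j)]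
  & (forall a, a < L -> m a.+1 = nth 0 (index_input s) a) /\
    (forall i : 'I_n, m (L + i.+1) = (i \in take j s))].

Lemma trunc_log2S m :
  trunc_log 2 m.+1 = (m.+1 == 2 ^ (trunc_log 2 m).+1) + trunc_log 2 m.
Proof.
have m_lt : m < 2 ^ (trunc_log 2 m).+1 by exact: trunc_log_ltn.
case: eqP => [mE|/eqP m_neq].
  by apply: trunc_log_eq => //; rewrite mE leqnn /= ltn_exp2l.
apply: trunc_log_eq => //; rewrite ltn_neqAle m_neq m_lt andbT.
by case: m {m_neq m_lt} => [|m] //; rewrite leqW // trunc_logP.
Qed.

(** The three paths through the loop have 6, 10 and 13 instructions: the index
    was seen before, or it is new, or moreover the count of distinct indices
    reaches a power of two. *)
Lemma loop_body j st : j < L -> word_bounded B st -> loop_inv j st ->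
  exists t st', [/\ t <= 13, exec certifier B t st st' & loop_inv j.+1 st'].
Proof.
move=> j_lt bst [r [m [stE [r0 r1 r2 r3] [r6 r7 r8 r9] [m_in m_seen]]]].
rewrite {st}stE in bst *.
have n_le := cover_size; have L_gt0 := cover_size_gt0; have L_le := cover_size_le.
have x0 : 'I_n by exact: Ordinal n_gt0.
pose x := nth x0 s j.
have xE : x = nth x s j by exact: set_nth_default.
have m_x : m j.+1 = x.+1 by rewrite m_in // (nth_map x0).
have x_lt := ltn_ord x.
have seen_j := seenS j_lt xE.
have arr_j := partial_arrivalS j_lt xE.
have seen_le_n := seen_le j.+1.
have arr_le : partial_arrival j.+1 <= B.
  apply: leq_trans (partial_arrival_le _) (leq_trans _ B_large); nia.
have log_le : trunc_log 2 (seen j.+1) <= L.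
  exact: leq_trans (trunc_log2_le _) (leq_trans seen_le_n n_le).
have mem_take i : (i \in take j.+1 s) = (i == x) || (i \in take j s).
  by rewrite (take_nth x) // mem_rcons inE -xE.
set r_ := update (update (update (update r 3 j.+1) 4 x.+1) 4 (x.+1 + L)) 5 (x \in take j s).
(* The part common to the three paths. *)
have prefix t st' :
    (word_bounded B (RamState 9 r_ m) -> exec certifier B t (RamState 9 r_ m) st') ->
    exec certifier B (5 + t) (RamState 3 r m) st'.
{ move=> ex.
  apply: (@exec_jump _ _ _ _ _ _ 5) => //; first by rewrite /ram_step /= r2 r3 j_lt.
  apply: (@exec_reg _ _ 3 j.+1 _ _ _ _ 6) => [|//||{}bst]; last 1 first.
  apply: (@exec_reg _ _ 4 x.+1 _ _ _ _ 7) => [|//||{}bst]; last 1 first.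
  apply: (@exec_reg _ _ 4 (x.+1 + L) _ _ _ _ 8) => [|//||{}bst]; last 1 first.
  apply: (@exec_reg _ _ 5 (x \in take j s) _ _ _ _ 9) => [|//||{}bst]; last 1 first.
  exact: ex.
  all: rewrite /ram_step /update /= ?r1 ?r2 ?r3 ?m_x ?[_ + L]addnC ?m_seen ?addn1 //; lia. }
have [x_seen|x_new] := boolP (x \in take j s).
  exists 6; exists (RamState 3 r_ m); split=> //.
    apply: (@prefix 1) => {}bst.
    apply: (@exec_jump _ _ _ _ _ _ 3) => //; last exact: exec_refl.
    by rewrite /ram_step /r_ /update /= r0 x_seen.
  exists r_, m; split=> //.
    by rewrite /r_ /update /= seen_j arr_j x_seen r6 r7 r8 r9.
  by split=> // i; rewrite m_seen mem_take; case: eqP => // ->; rewrite x_seen.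
rewrite (negbTE x_new) in arr_j; rewrite x_new add1n in seen_j.
set r1_ := update (update r_ 6 (seen j.+1)) 7 (partial_arrival j.+1).
set m_ := update m (L + x.+1) 1.
(* The part common to the two paths for a new index. *)
have middle t st' :
    (word_bounded B (RamState 13 r1_ m_) -> exec certifier B t (RamState 13 r1_ m_) st') ->
    exec certifier B (9 + t) (RamState 3 r m) st'.
{ move=> ex; apply: (prefix (4 + t)) => {}bst.
  apply: (@exec_jump _ _ _ _ _ _ 10) => //.
    by rewrite /ram_step /r_ /update /= r0 (negbTE x_new).
  apply: (@exec_mem _ _ (L + x.+1) 1 _ _ _ _ 11) => [|//||{}bst]; last 1 first.
  apply: (@exec_reg _ _ 6 (seen j.+1) _ _ _ _ 12) => [|//||{}bst]; last 1 first.
  apply: (@exec_reg _ _ 7 (partial_arrival j.+1) _ _ _ _ 13) => [|//||{}bst]; last 1 first.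
  exact: ex.
  all: rewrite /ram_step /r_ /m_ /update /= ?r1 ?r6 ?r7 ?seen_j ?arr_j.
  all: rewrite ?[partial_arrival j + _]addnC ?[x.+1 + L]addnC ?addn1 //; lia. }
have final t r' : t <= 13 -> (forall a, a != 8 -> a != 9 -> r' a = r1_ a) ->
    r' 8 = 2 ^ (trunc_log 2 (seen j.+1)).+1 -> r' 9 = trunc_log 2 (seen j.+1) ->
    exec certifier B t (RamState 3 r m) (RamState 3 r' m_) ->
    exists t st', [/\ t <= 13, exec certifier B t (RamState 3 r m) st' & loop_inv j.+1 st'].
{ move=> t_le r'_eq r'8 r'9 ex; exists t, (RamState 3 r' m_); split=> //.
  exists r', m_; split=> //.
    by rewrite !r'_eq.
    by split=> //; rewrite r'_eq.
  split=> [a a_lt|i]; rewrite /m_ /update.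
    by rewrite ltn_eqF ?m_in // addnS ltnS ltn_addr.
  by rewrite eqn_add2l eqSS m_seen mem_take -val_eqE /=; case: eqP. }
have logS := trunc_log2S (seen j).
rewrite -seen_j in logS.
have pow_gt := @trunc_log_ltn 2 (seen j) isT.
case: eqP logS => [pow_eq|pow_neq]; rewrite ?add0n ?add1n => logS.
  apply: (@final 13 (update (update r1_ 9 (trunc_log 2 (seen j.+1))) 8
    (2 ^ (trunc_log 2 (seen j.+1)).+1))) => //.
    by move=> a; rewrite /update => /negbTE -> /negbTE ->.
  apply: (@middle 4) => {}bst.
  have pow_le : 2 ^ (trunc_log 2 (seen j.+1)).+1 <= B.
    by rewrite logS expnS -pow_eq; lia.
  apply: (@exec_jump _ _ _ _ _ _ 14) => //.
    by rewrite /ram_step /r1_ /r_ /update /= r8 -pow_eq ltnn.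
  apply: (@exec_reg _ _ 9 (trunc_log 2 (seen j.+1)) _ _ _ _ 15) => [|//||{}bst]; last 1 first.
  apply: (@exec_reg _ _ 8 (2 ^ (trunc_log 2 (seen j.+1)).+1) _ _ _ _ 16) => [|//||{}bst]; last 1 first.
  apply: (@exec_jump _ _ _ _ _ _ 3) => //; exact: exec_refl.
  { by rewrite /ram_step /r1_ /r_ /update /= r8 logS addnn -mul2n -expnS. }
  { exact: pow_le. }
  { by rewrite /ram_step /r1_ /r_ /update /= r1 r9 addn1 logS. }
  { lia. }
apply: (@final 10 r1_) => //.
  by rewrite /r1_ /r_ /update /= r8 logS.
  by rewrite /r1_ /r_ /update /= r9 logS.
apply: (@middle 1) => {}bst.
apply: (@exec_jump _ _ _ _ _ _ 3) => //; last exact: exec_refl.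
rewrite /ram_step /r1_ /r_ /update /= r8 ifT //; lia.
Qed.

Lemma exec_bounded t st st' : exec certifier B t st st' -> word_bounded B st'.
Proof. by elim. Qed.

Lemma loop_run st : word_bounded B st -> loop_inv 0 st ->
  exists t st', [/\ t <= 13 * L, exec certifier B t st st' & loop_inv L st'].
Proof.
move=> bst inv0; suff : forall j, j <= L ->
  exists t st', [/\ t <= 13 * j, exec certifier B t st st' & loop_inv j st'] by exact.
elim=> [|j IH] j_le; first by exists 0, st; split=> //; exact: exec_refl.
have [t [st' [t_le ex inv_j]]] := IH (ltnW j_le).
have [t' [st'' [t'_le ex' inv_j']]] := loop_body j_le (exec_bounded ex) inv_j.
exists (t + t'), st''; split=> //; last exact: exec_trans ex ex'.
by rewrite mulnS addnC leq_add.
Qed.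

Lemma certifier_run : exists t st', [/\ t <= 13 * L + 11,
  exec certifier B t (ram_init (index_input s)) st' &
  ram_answer certifier st' = Some (certified s)].
Proof.
have n_le := cover_size; have L_gt0 := cover_size_gt0; have L_le := cover_size_le.
set m0 := mem (ram_init (index_input s)).
have b0 : word_bounded B (ram_init (index_input s)).
  move=> a; split=> //=; rewrite size_map; case: a => [|a] /=; first by lia.
  have [a_lt|a_ge] := ltnP a L; last by rewrite nth_default // size_map.
  rewrite (nth_map (Ordinal n_gt0)) //.
  move: (nth _ s a) => y; have := ltn_ord y; rewrite /=; lia.
pose r0 := update (update (update (fun=> 0) 1 1) 2 L) 8 2.
have init t st' : (word_bounded B (RamState 3 r0 m0) -> exec certifier B t (RamState 3 r0 m0) st') ->
    exec certifier B (3 + t) (ram_init (index_input s)) st'.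
{ move=> ex.
  apply: (@exec_reg _ _ 1 1 _ _ _ _ 1) => [|//||bst]; last 1 first.
  apply: (@exec_reg _ _ 2 L _ _ _ _ 2) => [|//||{}bst]; last 1 first.
  apply: (@exec_reg _ _ 8 2 _ _ _ _ 3) => [|//||{}bst]; last 1 first.
  exact: ex.
  all: rewrite /ram_step /= ?size_map //; lia. }
have ex3 := init _ _ (@exec_refl _ _ _).
have b3 := exec_bounded ex3.
have inv0 : loop_inv 0 (RamState 3 r0 m0).
  exists r0, m0; split=> //.
    rewrite /seen /partial_arrival take0.
    have -> : #|[pred i in [::] : seq 'I_n]| = 0 by apply: eq_card0.
    by rewrite big_pred0.
  split=> [a a_lt //|i]; rewrite take0 in_nil.
  by rewrite /m0 addnS /= nth_default // size_map leq_addr.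
have [t1 [st1 [t1_le ex1 [r [m [st1E [r_0 r_1 r_2 r_3] [r_6 r_7 _ r_9] _]]]]]] := loop_run b3 inv0.
have seenE : seen L = n.
  rewrite /seen take_size -[RHS]card_ord; apply: eq_card => i; by rewrite !inE s_covers.
have arrE : partial_arrival L = total_arrival s.
  by rewrite /partial_arrival take_size; apply: eq_bigl => i; rewrite s_covers.
rewrite seenE in r_6 r_9; rewrite arrE in r_7.
have b1 := exec_bounded ex1.
have bound2 : n * n * 16 <= B.
  by apply: leq_trans B_large; rewrite mulnC leq_mul2l leq_mul.
have bound1 : n * trunc_log 2 n <= B.
  apply: leq_trans bound2; apply: leq_trans (leq_pmulr _ _) => //.
  by rewrite leq_mul2l trunc_log2_le orbT.
suff [t2 [st2 [t2_le ex2 ans]]] : exists t2 st2, [/\ t2 <= 8, exec certifier B t2 st1 st2 &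
   ram_answer certifier st2 = Some (certified s)].
  exists (3 + 0 + (t1 + t2)), st2; split=> //; first by lia.
  exact: exec_trans ex3 (exec_trans ex1 ex2).
rewrite {}st1E {ex1} in b1 *.
pose r5 := update r 5 (n * trunc_log 2 n).
have phase t st' : (word_bounded B (RamState 18 r5 m) -> exec certifier B t (RamState 18 r5 m) st') ->
   exec certifier B (3 + t) (RamState 3 r m) st'.
{ move=> ex.
  apply: (@exec_jump _ _ _ _ _ _ 4) => //; first by rewrite /ram_step /= r_2 r_3 ltnn.
  apply: (@exec_jump _ _ _ _ _ _ 17) => //.
  apply: (@exec_reg _ _ 5 (n * trunc_log 2 n) _ _ _ _ 18) => //.
  by rewrite /ram_step /= r_6 r_9. }
rewrite /certified; have [L_small|L_large] /= := leqP (size s) _; last first.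
  exists 4, (RamState 24 r5 m); split=> //.
  apply: (@phase 1) => bst.
  apply: (@exec_jump _ _ _ _ _ _ 24) => //; last exact: exec_refl.
  by rewrite /ram_step /r5 /update /= r_2 L_large.
pose r6 := update (update (update r5 5 (n * n)) 4 16) 5 (n * n * 16).
exists 8, (RamState (if 16 * n ^ 2 < total_arrival s then 24 else 23) r6 m); split=> //.
  apply: (@phase 5) => bst.
  apply: (@exec_jump _ _ _ _ _ _ 19) => //.
    by rewrite /ram_step /r5 /update /= r_2 ltnNge L_small.
  apply: (@exec_reg _ _ 5 (n * n) _ _ _ _ 20) => [|//||{}bst].
    by rewrite /ram_step /r5 /update /= r_6.
    by apply: leq_trans bound2; rewrite leq_pmulr.
  apply: (@exec_reg _ _ 4 16 _ _ _ _ 21) => [|//||{}bst] //; first by lia.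
  apply: (@exec_reg _ _ 5 (n * n * 16) _ _ _ _ 22) => [|//|//|{}bst] //.
  apply: (@exec_jump _ _ _ _ _ _ (if 16 * n ^ 2 < total_arrival s then 24 else 23)) => //; last exact: exec_refl.
  by rewrite /ram_step /r6 /r5 /update /= r_7 [n * n * 16]mulnC.
by rewrite ltnNge; case: leqP.
Qed.
End Certifier.

(** The running time [13 L + 11] is at most [24 L], as [1 <= L]; the exponent
    [24] is ample, since the words stay at most [16 L^2]. *)
Lemma certifier_linear_time n (s : seq 'I_n) : 0 < n -> (forall i, i \in s) ->
  answers_in_linear_time certifier 24 (index_input s) (certified s).
Proof.
move=> n_gt0 s_covers.
have L_gt0 := cover_size_gt0 n_gt0 s_covers.
have B_large : 16 * (size s * size s) <= (size (index_input s)).+1 ^ 24.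
  rewrite size_map (expnD _ 22 2) leq_mul //; last by rewrite -mulnn leq_mul.
  by apply: (@leq_trans (2 ^ 22)); rewrite // leq_exp2r.
have [t [st [t_le /exec_iter [run bnd] ans]]] := certifier_run n_gt0 s_covers B_large.
exists t; split=> [||t' t'_le a]; last exact: bnd.
  rewrite size_map (leq_trans t_le) // (mulnDl 13 11) leq_add2l.
  exact: leq_pmulr.
by rewrite /ram_run run.
Qed.

End LinearTime.

(** * The event *)

Lemma trunc_log2_le_ln (R : realType) n : (0 < n)%N ->
  (n * trunc_log 2 n)%:R <= 2 * n%:R * ln (n%:R : R).
Proof.
move=> n_gt0; set k := trunc_log 2 n.
have half_le : expR 2^-1 <= 2 :> R.
  have := expR_ge1Dx (- 2^-1 : R); rewrite expRN => h.
  have e_gt0 := expR_gt0 (2^-1 : R).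
  rewrite -(@ler_pM2r _ (expR 2^-1)^-1) ?invr_gt0 // divff ?gt_eqF //; lra.
have k_le : k%:R / 2 <= ln n%:R :> R.
  rewrite -ler_expR lnK ?posrE ?ltr0n // expRM_natl.
  apply: le_trans (_ : (2 ^ k)%:R <= _); last by rewrite ler_nat trunc_logP.
  by rewrite natrX lerXn2r ?nnegrE ?expR_ge0.
have n_ge0 : 0 <= n%:R :> R by exact: ler0n.
rewrite natrM; nra.
Qed.

Section FirstCover.
Variables (n : nat) (x : nat -> 'I_n).

Lemma mkseq_cat l m : (l <= m)%N ->
  mkseq x m = mkseq x l ++ [seq x i | i <- iota l (m - l)].
Proof. by move=> lm; rewrite /mkseq -map_cat -[l in iota l]add0n -iotaD subnKC. Qed.

Lemma first_cover_le L m : first_cover_time x L ->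
  (forall i, i \in mkseq x m) <-> (L <= m)%N.
Proof.
move=> [L_covers L_first]; split=> [m_covers|Lm i].
  by rewrite leqNgt; apply/negP => /L_first.
by rewrite (mkseq_cat Lm) mem_cat L_covers.
Qed.

Lemma first_cover_exists m : (forall i, i \in mkseq x m) ->
  exists L, first_cover_time x L.
Proof.
move=> /unseen_eq0 m_covers.
have [L /unseen_eq0 L_covers L_min] :=
  ex_minnP (ex_intro (fun l => unseen (mkseq x l) == 0%N) m m_covers).
exists L; split=> // l lL /unseen_eq0 /L_min.
by rewrite leqNgt lL.
Qed.

(** Indices drawn after the covering time change no arrival time. *)
Lemma good_certified L : first_cover_time x L ->
  good (mkseq x (n * trunc_log 2 n)) = certified (mkseq x L).
Proof.
move=> x_L; rewrite /good /certified size_mkseq.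
set m := (n * _)%N; have m_L := first_cover_le m x_L.
have [Lm|mL] := leqP L m; last first.
  by apply/negbTE; rewrite negb_and; apply/orP; left; apply/unseen_eq0 => /m_L; rewrite leqNgt mL.
rewrite (introT (unseen_eq0 _) (m_L.2 Lm)) /=; congr (_ <= _)%N.
by apply: eq_bigr => i _; rewrite (mkseq_cat Lm) index_cat x_L.1.
Qed.

End FirstCover.

Theorem theorem3p2 (R : realType) :
  exists (eps : nat -> R) (prog : seq instr) (c : nat),
    eps @ \oo --> 0 /\
    forall (F : scalar_kind) (H : completeNormedModType (scalar R F))
      (ip : {dot H for @scalar_conj R F}) (ip_norm : forall f, `|f| ^+ 2 = ip f f)
      (n : nat) (n_ge1 : (1 <= n)%N) (delta : R)
      (P : 'I_n -> {linear H -> H})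
      (P_proj : forall i, orthogonal_projection ip (P i))
      (P_gap : op_norm (fun f : H => n%:R^-1 *: \sum_(i < n) P i f)
               <= 1 - delta)
      (d : measure_display) (Omega : measurableType d)
      (Pr : probability Omega R) (X : nat -> Omega -> 'I_n)
      (X_iid : iid_uniform Pr X),
    exists E : set Omega, [/\
      measurable E,
      Pr E = (1 - eps n)%:E,
      forall w, E w -> exists L, [/\
        first_cover_time (X ^~ w) L,
        L%:R <= 2 * n%:R * ln (n%:R : R)
      & op_norm (ordered_product P (mkseq (X ^~ w) L))
        <= 1 - delta / (32 * n%:R) ]
    & exists D : seq 'I_n -> bool,
        (forall w L, first_cover_time (X ^~ w) L ->
           E w <-> D (mkseq (X ^~ w) L)) /\
        (forall (x : nat -> 'I_n) L, first_cover_time x L ->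
           answers_in_linear_time prog c (index_input (mkseq x L))
             (D (mkseq x L))) ].
Proof.
exists (fun n => bad_fraction n R (n * trunc_log 2 n)), certifier, 24%N.
split; first exact: bad_fraction_cvg.
move=> F H ip ip_norm n n_ge1 delta P P_proj P_gap d Omega Pr X X_iid.
have [E_meas E_prob] :=
  probability_prefix n_ge1 X_iid (n * trunc_log 2 n) (@good n).
exists [set w | good (mkseq (X ^~ w) (n * trunc_log 2 n))]; split=> //.
- by rewrite E_prob good_fraction.
- move=> w /= Ew.
  have [L x_L] : exists L, first_cover_time (X ^~ w) L.
    by move: Ew => /andP[/unseen_eq0 /first_cover_exists].
  exists L; move: Ew; rewrite (good_certified x_L) => /andP[L_small early].
  rewrite size_mkseq in L_small; split=> //.
    by apply: le_trans (trunc_log2_le_ln R n_ge1); rewrite ler_nat.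
  exact: (op_norm_product_le ip_norm P_proj n_ge1 P_gap x_L.1).
- exists (@certified n); split=> [w L x_L|x L [x_covers _]].
    by rewrite /= (good_certified x_L).
  exact: certifier_linear_time.
Qed.
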